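(* Let $p$ be a propositional atom and let $H$ be a generic theory. Let $(T_{KP})_0$ be the smallest closed theory containing $H$ and the formula $p\leftrightarrow\mathrm{K}\neg p$, and let $T_{KP}=(T_{KP})_0\cup\mathbf{T}$. Then for every set $S$ of propositional atoms with $p\notin S$, $\mathscr M_{(T_{KP})_0,S}\models T_{KP}$. In particular, $T_{KP}$ is consistent.
   Context: Fix a nonempty set of symbols called propositional atoms and a symbol $\mathrm{K}$ which is not a propositional atom. Formulas are defined recursively: every propositional atom is a formula; if $\varphi,\psi$ are formulas then so are $\neg\varphi$, $(\varphi\wedge\psi)$, $(\varphi\vee\psi)$, $(\varphi\rightarrow\psi)$; if $\varphi$ is a formula then so is $\mathrm{K}(\varphi)$. $\varphi\leftrightarrow\psi$ abbreviates $(\varphi\rightarrow\psi)\wedge(\psi\rightarrow\varphi)$. A formula is basic if it is a propositional atom or of the form $\mathrm{K}\varphi$. A theory is a set of formulas. A model is a function assigning a truth value to every basic formula; truth $\mathscr M\models\varphi$ of an arbitrary formula is defined from the values of basic formulas by the classical truth tables (formulas $\mathrm{K}\varphi$ are treated like atoms). $\mathscr M\models T$ means $\mathscr M\models\varphi$ for all $\varphi\in T$; $T\models\varphi$ means every model of $T$ satisfies $\varphi$; $T$ is consistent if some model satisfies $T$. A theory $T$ is closed if $\varphi\in T$ implies $\mathrm{K}\varphi\in T$. $\mathbf{T}$ is the set of all formulas $\mathrm{K}\varphi\rightarrow\varphi$. For a theory $T$ and a set $S$ of propositional atoms, $\mathscr M_{T,S}$ is the model with $\mathscr M_{T,S}\models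 q$ iff $q\in S$ for atoms $q$, and $\mathscr M_{T,S}\models\mathrm{K}\varphi$ iff $T\models\varphi$. A theory $T$ is generic if for every set $S$ of propositional atoms and every theory $T'\supseteq T$, $\mathscr M_{T',S}\models T$. *)

(* Defs.v *)
From mathcomp Require Import all_boot.
From mathcomp Require Import boolp classical_sets.

Set Implicit Arguments.
Unset Strict Implicit.
Unset Printing Implicit Defensive.

Local Open Scope classical_set_scope.

Inductive formula (atom : Type) : Type :=
| Atom of atom
| Neg of formula atom
| And of formula atom & formula atom
| Or of formula atom & formula atom
| Imp of formula atom & formula atom
| K of formula atom.

Section Epistemic.
Variable atom : Type.
Implicit Types (phi psi : formula atom) (S : set atom).

Definition Iff phi psi : formula atom := And (Imp phi psi) (Imp psi phi).

Definition is_basic phi : bool :=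
  match phi with Atom _ | K _ => true | _ => false end.

Definition basic : Type := {phi : formula atom | is_basic phi}.

Definition theory : Type := set (formula atom).

Definition model : Type := basic -> bool.

(* In the two basic cases [isT] proves [is_basic] by computation. *)
Fixpoint holds (M : model) phi : bool :=
  match phi with
  | Atom q => M (exist _ (Atom q) isT)
  | Neg phi1 => ~~ holds M phi1
  | And phi1 phi2 => holds M phi1 && holds M phi2
  | Or phi1 phi2 => holds M phi1 || holds M phi2
  | Imp phi1 phi2 => holds M phi1 ==> holds M phi2
  | K phi1 => M (exist _ (K phi1) isT)
  end.

Definition satisfies (M : model) (T : theory) : Prop :=
  forall phi, T phi -> holds M phi.

Definition entails (T : theory) phi : Prop :=
  forall M : model, satisfies M T -> holds M phi.

Definition consistent (T : theory) : Prop := exists M : model, satisfies M T.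

Definition closed_theory (T : theory) : Prop := forall phi, T phi -> T (K phi).

Definition theoryT : theory := [set Imp (K phi) phi | phi in [set: formula atom]].

(* The model $\mathscr M_{T,S}$; the last branch is never reached, since [b] is
   basic. *)
Definition canonical_model (T : theory) S : model := fun b =>
  match sval b with
  | Atom q => `[< S q >]
  | K phi => `[< entails T phi >]
  | _ => false
  end.

Definition generic (T : theory) : Prop :=
  forall S (T' : theory), T `<=` T' -> satisfies (canonical_model T' S) T.

(* [smallest] is the intersection of all closed theories containing the given
   set; closedness is preserved by intersections, so this theory is itself
   closed. *)
Definition TKP0 (H : theory) (p : atom) : theory :=
  smallest closed_theory (H `|` [set Iff (Atom p) (K (Neg (Atom p)))]).

Definition TKP (H : theory) (p : atom) : theory := TKP0 H p `|` theoryT.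

End Epistemic.

(* Main.v *)
(* The model [canonical_model setT [set p]] makes [p] and every [K phi] true,
   so it satisfies [TKP0 H p]; hence [TKP0 H p] does not entail [Neg p]. If
   [~ S p], then [p] and [K (Neg p)] are therefore both false in
   [canonical_model (TKP0 H p) S], which thus satisfies [TKP0 H p]. Once a
   canonical model of a theory satisfies that theory, what the theory entails is
   true in it, which gives [K phi -> phi]. *)
Require Import Defs.
From mathcomp Require Import all_boot.
From mathcomp Require Import boolp classical_sets.

Local Open Scope classical_set_scope.

(** The members of the closure that hold in [M] form a closed theory containing [A], so they exhaust
    it. *)
Lemma satisfies_smallest_closed (atom : Type) (M : model atom) (A : theory atom) :
  satisfies M A ->
  (forall phi, smallest (@closed_theory atom) A phi -> holds M (K phi)) ->
  satisfies M (smallest (@closed_theory atom) A).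
Proof.
move=> MA MK phi Aphi.
(* Membership is kept in [B] because [MK] speaks only of members of the closure. *)
pose B : theory atom := [set psi | smallest (@closed_theory atom) A psi /\ holds M psi].
suff [] : B phi by [].
apply: Aphi; split=> [psi [Apsi _]|psi Apsi].
  by split; [move=> C CA; apply: CA.1; exact: Apsi | exact: MK].
by split; [exact: sub_gen_smallest | exact: MA].
Qed.

Lemma sub_TKP0 (atom : Type) (H : theory atom) (p : atom) :
  H `<=` TKP0 H p.
Proof. by move=> phi Hphi; apply: sub_gen_smallest; left. Qed.

Lemma TKP0_not_entails_neg (atom : Type) (p : atom) (H : theory atom) :
  generic H -> ~ entails (TKP0 H p) (Neg (Atom p)).
Proof.
move=> genH /(_ (canonical_model setT [set p])) /=.
have entT phi : entails (@setT (formula atom)) phi by move=> M; apply.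
rewrite /canonical_model /= asboolT //; apply/not_implyP; split=> //.
apply: satisfies_smallest_closed => [phi [Hphi|->]|phi _] /=.
(* Genericity applies with [setT] as the extension of [H]. *)
- exact: genH Hphi.
- by rewrite /canonical_model /= !asboolT.
- exact/asboolP.
Qed.

Lemma canonical_model_TKP0 (atom : Type) (p : atom) (H : theory atom)
    (S : set atom) :
  generic H -> ~ S p ->
  satisfies (canonical_model (TKP0 H p) S) (TKP0 H p).
Proof.
move=> genH Sp.
apply: satisfies_smallest_closed => [phi [Hphi|->]|phi Tphi] /=.
- exact: genH (@sub_TKP0 _ _ _) _ Hphi.
- rewrite /canonical_model /= !asboolF //; exact: TKP0_not_entails_neg.
(* A theory entails each of its members. *)
- by apply/asboolP => M; apply.
Qed.

Lemma canonical_model_theoryT (atom : Type) (T : theory atom) (S : set atom) :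
  satisfies (canonical_model T S) T ->
  satisfies (canonical_model T S) (@theoryT atom).
Proof. by move=> MT _ [phi _ <-] /=; apply/implyP => /asboolP; apply. Qed.

Theorem theorem19 (atom : Type) (p : atom) (H : theory atom)
    (genH : generic H) :
  (forall S : set atom, ~ S p ->
     satisfies (canonical_model (TKP0 H p) S) (TKP H p)) /\
  consistent (TKP H p).
Proof.
have MTKP S : ~ S p -> satisfies (canonical_model (TKP0 H p) S) (TKP H p).
  move=> Sp; have M0 := canonical_model_TKP0 _ _ _ _ genH Sp.
  by move=> phi [|]; [exact: M0 | exact: canonical_model_theoryT].
(* The empty set is a choice of [S] that omits [p]. *)
by split=> //; exists (canonical_model (TKP0 H p) set0); apply: MTKP.
Qed.
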